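(* Let $p$ be an odd prime and let $G$ be a finite $p$-group with $|G|=p^6$ and nilpotency class $cl(G)=3$ or $4$. Then $\mathrm{Aut}_z(G)=Z(\mathrm{Inn}(G))$ if and only if $d(G)=2$ and $|Z(G)|=p$.
   Context: For a group $G$: $Z(G)$ is the center of $G$; $\mathrm{Inn}(G)$ is the group of inner automorphisms of $G$ and $Z(\mathrm{Inn}(G))$ is its center; $d(G)$ (the rank of $G$) is the minimal number of generators of $G$; $cl(G)$ is the nilpotency class of $G$. An automorphism $\alpha$ of $G$ is central if $x^{-1}\alpha(x)\in Z(G)$ for all $x\in G$ (equivalently, $\alpha$ commutes with every inner automorphism of $G$). $\mathrm{Aut}_z(G)$ denotes the subgroup of $\mathrm{Aut}(G)$ consisting of all central automorphisms. *)

(* Defs.v *)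
From mathcomp Require Import all_boot all_fingroup all_solvable.

Set Implicit Arguments.
Unset Strict Implicit.
Unset Printing Implicit Defensive.

Import GroupScope.

(* [conj_aut G] sends g in 'N(G) to the conjugation automorphism x |-> x ^ g
   of G, as an element of [Aut G]. *)
Definition Inn (gT : finGroupType) (G : {group gT}) : {set {perm gT}} :=
  conj_aut G @* G.

Canonical Inn_group (gT : finGroupType) (G : {group gT}) :=
  [group of Inn G].

Definition Aut_z (gT : finGroupType) (G : {group gT}) : {set {perm gT}} :=
  [set a in Aut G | [forall x in G, x^-1 * a x \in 'Z(G)]].

Lemma Aut_z_group_set (gT : finGroupType) (G : {group gT}) :
  group_set (Aut_z G).
Proof.
apply/group_setP; split=> [|a b].
  apply/setIdP; split; first exact: group1.
  by apply/forall_inP=> x _; rewrite perm1 mulVg group1.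
move=> /setIdP[Aa /forall_inP Za] /setIdP[Ab /forall_inP Zb].
apply/setIdP; split; first exact: groupM.
apply/forall_inP=> x Gx; rewrite permM.
have Gax : a x \in G by rewrite Aut_closed.
rewrite -[X in _ * X](mulKVg (a x)) mulgA.
exact: groupM (Za x Gx) (Zb _ Gax).
Qed.

Canonical Aut_z_group (gT : finGroupType) (G : {group gT}) :=
  Group (Aut_z_group_set G).

(* Main.v *)
Require Import Defs.
From mathcomp Require Import all_boot all_fingroup all_solvable.
From mathcomp Require Import all_algebra mxabelem.

Set Implicit Arguments.
Unset Strict Implicit.
Unset Printing Implicit Defensive.

Import GroupScope GRing.Theory.

(* If [f : G -> 'Z(G)] is a homomorphism killing ['Z(G)], then [x |-> x * f x]
   is a central automorphism; if it is inner, then [f x = [~ x, g]] for some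
   [g] in ['Z_2(G)]. Applied to all the homomorphisms from [G / 'Z(G) 'Phi(G)]
   to ['Ohm_1('Z(G))], which correspond to matrices over ['F_p], this bounds
   [#|'Z_2(G) : 'Z(G)|] from below. As [G / 'Z_2(G)] is not cyclic, there only
   remain the case that we want and two cases that are excluded separately.

   Conversely, if ['m(G) = 2] and [#|'Z(G)| = p] then a central automorphism is
   determined by the images of two generators, so [#|Aut_z G| <= p ^ 2], and it
   suffices that [#|'Z_2(G)| > p ^ 2]. If [#|'Z_2(G)| = p ^ 2] then [G^`(1)] is
   cyclic of order [p ^ 3], generated by some [a], and there is [k] such that
   [[~ a, k]] generates ['Z_2(G)]. The powers of [k] represent [G / 'C_G[a]],
   so [k ^+ (p ^ 2)], which is in [G^`(1)], is central, which forces
   [k \in 'Z_3(G)], hence [[~ a, k] \in 'Z(G)], a contradiction. *)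

(** * Central inner automorphisms and the second center *)

Lemma ucnSP (gT : finGroupType) (G : {group gT}) n x :
  reflect (x \in G /\ {in G, forall y, [~ x, y] \in 'Z_n(G)})
          (x \in 'Z_n.+1(G)).
Proof.
rewrite ucnSnR !inE; apply: (iffP andP) => -[Gx Zx]; split=> //.
  by move=> y Gy; apply: (subsetP Zx); rewrite mem_commg ?set11.
rewrite gen_subG; apply/subsetP=> _ /imset2P[_ y /set1P-> Gy ->].
exact: Zx.
Qed.

(** Here [x^-1 * x ^ g] is [[~ x, g]], so centrality is the condition defining ['Z_2(G)]. *)
Lemma conj_aut_Aut_z (gT : finGroupType) (G : {group gT}) g :
  g \in G -> (conj_aut G g \in Aut_z G) = (g \in 'Z_2(G)).
Proof.
move=> Gg; have Ag: conj_aut G g \in Aut G := Aut_aut _ _.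
rewrite inE Ag; apply/forall_inP/ucnSP=> [Zg | [_ Zg] x Gx].
  split=> // y Gy; rewrite ucn1 -groupV invg_comm.
  by rewrite commgEl -(conj_autE Gg Gy) Zg.
rewrite (conj_autE Gg Gx) -commgEl -ucn1 -groupV invg_comm.
exact: Zg.
Qed.

(** On [G] the kernel of [conj_aut] is ['Z(G)], so two conjugations commute iff the commutator of
    the conjugating elements is central. *)
Lemma center_Inn (gT : finGroupType) (G : {group gT}) :
  'Z(Inn G) = conj_aut G @* 'Z_2(G).
Proof.
have nGG := normG G.
have kerE g : g \in G -> (conj_aut G g == 1) = (g \in 'Z(G)).
  move=> Gg; rewrite (sameP eqP (kerP _ (subsetP nGG g Gg))) ker_conj_aut.
  by rewrite [in RHS]inE Gg.
have conjR g h : g \in G -> h \in G ->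
    (commute (conj_aut G g) (conj_aut G h)) <-> [~ g, h] \in 'Z(G).
  move=> Gg Gh; rewrite -kerE ?groupR //.
  rewrite morphR ?(subsetP nGG) //; split; first by move/commgP.
  by move/commgP.
apply/setP=> a; apply/centerP/morphimP=> [[] | [g _ Z2g ->]].
  case/morphimP=> g Ng Gg -> cg; exists g => //; apply/ucnSP; split=> // h Gh.
  rewrite ucn1; apply/conjR=> //; apply: cg.
  by rewrite mem_morphim // (subsetP nGG).
have [Gg Zg] := ucnSP _ _ _ Z2g; split.
  by rewrite mem_morphim // (subsetP nGG).
move=> _ /morphimP[h _ Gh ->]; apply/conjR=> //.
by rewrite -ucn1 Zg.
Qed.

Lemma center_Inn_sub_Aut_z (gT : finGroupType) (G : {group gT}) :
  'Z(Inn G) \subset Aut_z G.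
Proof.
rewrite center_Inn; apply/subsetP=> _ /morphimP[g _ Z2g ->].
by rewrite conj_aut_Aut_z // (subsetP (ucn_sub 2 G)).
Qed.

Lemma card_center_Inn (gT : finGroupType) (G : {group gT}) :
  #|'Z(Inn G)| = #|'Z_2(G) : 'Z(G)|.
Proof.
have sZG := ucn_sub 2 G.
have sZ1Z2: 'Z(G) \subset 'Z_2(G) by rewrite -ucn1 ucn_subS.
rewrite center_Inn card_morphim ker_conj_aut.
have /setIidPr->: 'Z_2(G) \subset 'N(G) := subset_trans sZG (normG G).
suffices ->: 'Z(G) = 'Z_2(G) :&: 'C(G) by rewrite indexgI.
apply/eqP; rewrite eqEsubset subsetI sZ1Z2 subsetIr /=.
by rewrite subsetI subsetIr subIset ?sZG.
Qed.

(** * Generator rank, commutator identities and small p-groups *)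

Lemma card_Frattini_quotient (gT : finGroupType) (G : {group gT}) (p : nat) :
  p.-group G -> #|G : 'Phi(G)| = (p ^ 'm(G))%N.
Proof.
move=> pG; have nPhiG := gFnorm _ G : G \subset 'N('Phi(G)).
have abG := Phi_quotient_abelem pG.
rewrite -card_quotient //.
suffices ->: 'm(G) = 'm(G / 'Phi(G)).
  have [G1 | ntG] := eqVneq (G / 'Phi(G)) 1.
    rewrite G1 cards1; apply/esym/eqP; rewrite -[X in _ == X](expn0 p).
    by rewrite (grank_abelian (abelian1 _)) /= rank1 eqxx.
  by rewrite grank_abelian ?(abelem_abelian abG) // (rank_abelem abG)
             -(card_pgroup (abelem_pgroup abG)).
apply/eqP; rewrite eqn_leq quotient_grank // andbT.
have [/= Xb defGb <-] := grank_witness (G / 'Phi(G)).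
(* Representatives of generators of the Frattini quotient generate [G], since ['Phi(G)] consists of
   non-generators. *)
pose X := (repr \o val : coset_of _ -> gT) @: Xb.
have sPG := Phi_sub G.
have sXG: X \subset G; last have nPX := subset_trans sXG nPhiG.
  apply/subsetP=> _ /imsetP[xb Xxb ->]; have nPx := repr_coset_norm xb.
  rewrite -sub1set -(quotientSGK _ sPG) ?sub1set ?quotient_set1 //= sub1set.
  by rewrite coset_reprK -defGb mem_gen.
have defG: <<X>> = G.
  apply: Phi_nongen; apply/eqP; rewrite eqEsubset join_subG sPG sXG -joing_idr.
  rewrite -genM_join sub_gen // -quotientSK ?quotient_gen // -defGb genS //.
  apply/subsetP=> xb Xxb; apply/imsetP; rewrite (setIidPr nPX).
  by exists (repr xb); rewrite /= ?coset_reprK //; apply: imset_f.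
rewrite -[in 'm(G)]defG.
exact: leq_trans (grank_min _) (leq_imset_card _ _).
Qed.

(** Expanding the [n]-th power of [x ^ y = x * [~ x, y]] leaves the correction [z ^+ 'C(n, 2)], and
    an odd [n] divides ['C(n, 2)]. *)
Lemma commXg_odd (gT : finGroupType) n (x y : gT) :
    odd n -> let z := [~ [~ x, y], x] in
    commute [~ x, y] z -> commute x z -> z ^+ n = 1 ->
  [~ x ^+ n, y] = [~ x, y] ^+ n.
Proof.
move=> odd_n z ccz cxz zn1.
rewrite commgEl conjXg conjg_mulR expMg_Rmul // bin2odd //.
by rewrite expgM zn1 expg1n mulg1 mulKg.
Qed.

(** The three subgroup lemma settles [n = 0]; the general case is that one in [G / 'Z_n(G)]. *)
Lemma der1_comm_ucn (gT : finGroupType) (G : {group gT}) n :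
  [~: G^`(1), 'Z_n.+2(G)] \subset 'Z_n(G).
Proof.
have comm2 (rT : finGroupType) (H : {group rT}) : [~: H^`(1), 'Z_2(H)] = 1.
  have cZ2H : [~: 'Z_2(H), H, H] = 1.
    apply/trivgP; rewrite -(ucn0 H).
    by apply: subset_trans (commSg _ (ucn_comm 1 H)) (ucn_comm 0 H).
  by apply: three_subgroup => //; rewrite [[~: H, 'Z_2(H)]]commGC.
have nZG := ucn_norm n G; have sZG := ucn_sub n.+2 G.
rewrite -quotient_cents2 ?(subset_trans _ nZG) ?der_sub //.
rewrite quotient_der // -[n.+2]/(2 + n)%N quotient_ucn_add.
exact/commG1P/comm2.
Qed.

Lemma cycle_expg_eq1 (gT : finGroupType) p n (u w : gT) :
    prime p -> #[u] = (p ^ n.+1)%N -> w \in <[u]> -> w ^+ (p ^ n) = 1 ->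
  w \in <[u ^+ p]>.
Proof.
move=> p_pr ou /cycleP[i ->] /eqP; rewrite -expgM -order_dvdn ou expnS.
rewrite dvdn_pmul2r ?expn_gt0 ?prime_gt0 // => /dvdnP[j ->].
by rewrite mulnC expgM mem_cycle.
Qed.

Lemma noncyclic_p2_abelem (gT : finGroupType) (H : {group gT}) (p : nat) :
  prime p -> #|H| = (p ^ 2)%N -> ~~ cyclic H -> p.-abelem H.
Proof.
move=> p_pr oH ncH; have pH : p.-group H by rewrite /pgroup oH pnatX pnat_id.
apply/abelemP=> //; split=> [|x Hx].
  by apply: p2group_abelian pH _; rewrite oH pfactorK.
have [n ox] := p_natP (mem_p_elt pH Hx).
have n_le1 : n <= 1.
  rewrite leqNgt; apply: contra ncH => n_gt1; apply/cyclicP; exists x.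
  apply/esym/eqP; rewrite eqEcard cycle_subG Hx oH -orderE ox.
  by rewrite leq_exp2l ?(prime_gt1 p_pr).
by apply/eqP; rewrite -order_dvdn ox -[X in _ %| X]expn1 dvdn_exp2l.
Qed.

(** Serves to bound the derived subgroup of a quotient by the order of a single commutator. *)
Lemma der1_grank2 (gT : finGroupType) (H : {group gT}) :
    'm(H) <= 2 -> H^`(1) \subset 'Z(H) ->
  exists x y, [/\ x \in H, y \in H & H^`(1) = <[[~ x, y]]>].
Proof.
move=> mH sDZ; have [B defB oB] := grank_witness H.
have [x [y [Hx Hy defH]]] :
    exists x y, [/\ x \in H, y \in H & H :=: <[x]> <*> <[y]>].
  (* If there are fewer than two generators, [1] fills the gap. *)
  move: mH; rewrite -oB leq_eqVlt => /orP[/cards2P[x [y [_ defxy]]]|].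
    exists x, y; rewrite joing_idl joing_idr -defB defxy.
    by rewrite !mem_gen ?set21 ?set22.
  rewrite ltnS leq_eqVlt => /orP[/cards1P[x defx] | ].
    have defHx : <[x]> = H by rewrite -defB defx.
    by exists x, 1; rewrite group1 cycle1 joingG1 -{1}defHx cycle_id.
  rewrite ltnS leqn0 cards_eq0 => /eqP B0.
  exists 1, 1; split; rewrite ?group1 // cycle1 joingG1.
  by rewrite -defB B0 gen0.
exists x, y; split=> //; rewrite defH der1_joing_cycles // -defH.
have : [~ x, y] \in 'Z(H) by rewrite (subsetP sDZ) ?mem_commg.
by case/setIP.
Qed.

(** * Two generators and a center of order p: excluding a second center of order p^2 *)

Section TwoGenerator.

Variables (gT : finGroupType) (G : {group gT}) (p : nat).
Hypotheses (p_pr : prime p) (p_odd : odd p) (pG : p.-group G).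
Hypotheses (oG : #|G| = (p ^ 6)%N) (clG : nil_class G <= 4).
Hypotheses (mG : 'm(G) = 2) (oZ : #|'Z(G)| = p).

Lemma card_ucn2_neq : #|'Z_2(G)| <> (p ^ 2)%N.
Proof.
move=> oZ2; have nilG := pgroup_nil pG.
have sZ2G := ucn_sub 2 G; have nZ2G := ucn_norm 2 G.
have sZZ2 : 'Z(G) \subset 'Z_2(G) by rewrite -ucn1 ucn_subS.
have sZG := center_sub G; have nZG := gFnorm _ G : G \subset 'N('Z(G)).
have sDG := der_sub 1 G.
have p_gt1 := prime_gt1 p_pr.
have Zp z : z \in 'Z(G) -> z ^+ p = 1.
  by move=> Zz; apply/eqP; rewrite -order_dvdn -oZ order_dvdG.
have Z2p u : u \in 'Z_2(G) -> u ^+ p \in 'Z(G).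
  move=> Z2u; have Nu := subsetP nZG u (subsetP sZ2G u Z2u).
  rewrite coset_idr ?groupX // morphX //.
  apply/eqP; rewrite -order_dvdn.
  have <- : #|'Z_2(G) / 'Z(G)| = p.
    rewrite card_quotient ?(subset_trans sZ2G) // -divgS // oZ2 oZ.
    by rewrite expnS expn1 mulnK ?prime_gt0.
  by rewrite order_dvdG ?mem_quotient.
have D3 : [~: G^`(1), G] \subset 'Z_2(G).
  have Z4 : 'Z_4(G) = G by apply/(ucn_nil_classP 4 nilG).
  apply: subset_trans (ucn_comm 2 G); apply: commSg.
  by apply: subset_trans (ucn_comm 3 G); rewrite Z4.
have DG a g : a \in G^`(1) -> g \in G -> [~ a, g] \in 'Z_2(G).
  by move=> Da Gg; rewrite (subsetP D3) ?mem_commg.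
have cDZ2 a u : a \in G^`(1) -> u \in 'Z_2(G) -> commute a u.
  move=> Da Z2u; apply/commgP; rewrite -in_set1 -[[set 1]](ucn0 G).
  by rewrite (subsetP (der1_comm_ucn G 0)) ?mem_commg.
have GR g h : g \in G -> h \in G -> [~ g, h] \in G^`(1).
  exact: mem_commg.
have DX a g n : a \in G^`(1) -> g \in G -> [~ a ^+ n, g] = [~ a, g] ^+ n.
  by move=> Da Gg; rewrite commXg //; apply: cDZ2; rewrite ?DG.
have Dp a : a \in G^`(1) -> a ^+ p \in 'Z_2(G).
  move=> Da; apply/ucnSP; split=> [|g Gg].
    by rewrite groupX ?(subsetP sDG).
  by rewrite DX // ucn1 Z2p // DG.
(* In [G / 'Z(G)] the image of [[~ [~ g, h], g]] is central and killed by [p], so [commXg_odd]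
   applies there. *)
have commXp g h : g \in G -> h \in G ->
    coset 'Z(G) [~ g ^+ p, h] = coset 'Z(G) ([~ g, h] ^+ p).
  move=> Gg Gh; have [Ng Nh] := (subsetP nZG g Gg, subsetP nZG h Gh).
  rewrite morphR ?groupX // !morphX ?groupR //= morphR //=.
  have Z2z : [~ [~ g, h], g] \in 'Z_2(G) by rewrite DG ?GR.
  have cz k : k \in G -> commute (coset 'Z(G) k)
      [~ [~ coset 'Z(G) g, coset 'Z(G) h], coset 'Z(G) g].
    move=> Gk; apply/commute_sym/commgP.
    rewrite -!morphR ?groupR ?(subsetP nZG) //=.
    rewrite coset_id // -ucn1; have [_ ->] := ucnSP _ _ _ Z2z => //.
  apply: commXg_odd => //; last 2 first.
  - exact: cz.
  - rewrite -!morphR ?groupR // -morphX ?groupR //= coset_id //.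
    exact: Z2p.
  by rewrite -[X in commute X _]morphR //=; apply: cz; rewrite groupR.
(* The derived subgroup of [G / 'Z_2(G)] is generated by one commutator, whose [p]-th power is
   trivial by [Dp]. *)
have oD2 : #|G^`(1) / 'Z_2(G)| <= p.
  have mGZ2 : 'm(G / 'Z_2(G)) <= 2.
    by rewrite (leq_trans (quotient_grank nZ2G)) ?mG.
  have sDZ : (G / 'Z_2(G))^`(1) \subset 'Z(G / 'Z_2(G)).
    by rewrite subsetI der_sub /= -quotient_der // quotient_cents2r.
  have [_ [_ [/morphimP[x Nx Gx ->] /morphimP[y Ny Gy ->] defD]]] :=
    der1_grank2 mGZ2 sDZ.
  rewrite quotient_der // defD -morphR //= -orderE.
  rewrite dvdn_leq ?prime_gt0 // order_dvdn -morphX ?groupR //.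
  by rewrite /= coset_id // Dp ?GR.
have oPhi : #|'Phi(G)| = (p ^ 4)%N.
  have := Lagrange (Phi_sub G); rewrite (card_Frattini_quotient pG) mG oG.
  rewrite (expnD p 4 2) => /eqP; rewrite eqn_pmul2r ?expn_gt0 ?prime_gt0 //.
  by move/eqP.
(* Otherwise [commXp] puts all [p]-th powers in ['Z_2(G)], and ['Phi(G)], of order [p ^ 4], would
   lie in a group of order at most [p * p ^ 2]. *)
have [a Da nZa] : exists2 a, a \in G^`(1) & a ^+ p \notin 'Z(G).
  have [/existsP[g /andP[Gg /existsP[h /andP[Gh nZ]]]] | /existsPn noE] :=
    boolP [exists g in G, exists h in G, [~ g, h] ^+ p \notin 'Z(G)].
    by exists [~ g, h]; rewrite ?GR.
  have sPhi : 'Phi(G) \subset G^`(1) <*> 'Z_2(G).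
    rewrite (Phi_joing pG) join_subG joing_subl (MhoE 1 pG) gen_subG /=.
    apply/subsetP=> _ /imsetP[g Gg ->]; rewrite expn1.
    apply: (subsetP (joing_subr _ _)); apply/ucnSP; split=> [|h Gh].
      exact: groupX.
    have [Ng Nh] := (subsetP nZG g Gg, subsetP nZG h Gh).
    rewrite ucn1 coset_idr ?groupR ?groupX // commXp // coset_id //.
    have := noE g; rewrite negb_and Gg /= => /existsPn/(_ h).
    by rewrite negb_and Gh /= negbK.
  have := subset_leq_card sPhi; rewrite oPhi leqNgt => /negP[].
  have nZ2D : G^`(1) <*> 'Z_2(G) \subset 'N('Z_2(G)).
    by rewrite join_subG (subset_trans sDG) ?normG.
  rewrite -(Lagrange (joing_subr G^`(1) 'Z_2(G))) -card_quotient //.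
  rewrite quotientYidr ?(subset_trans sDG) // oZ2.
  rewrite (expnD p 2 2) ltn_pmul2l ?expn_gt0 ?prime_gt0 //.
  by apply: leq_ltn_trans oD2 _; rewrite -[X in X < _]expn1 ltn_exp2l.
have Ga := subsetP sDG a Da.
have nZ2a : a \notin 'Z_2(G) by apply: contra nZa => /Z2p.
have [k Gk ntk] : exists2 k, k \in G & [~ a ^+ p, k] != 1.
  apply/exists_inP; apply: contraR nZa => /exists_inPn cap.
  apply/centerP; split; first exact: groupX.
  by move=> k Gk; apply/commgP; have := cap k Gk; rewrite negbK.
rewrite DX // in ntk; set u := [~ a, k] in ntk.
have Z2u : u \in 'Z_2(G) by apply: DG.
have ou : #[u] = (p ^ 2)%N.
  rewrite expnS expn1; apply: orderXprime => //.
  by apply: nt_prime_order => //; apply/Zp/Z2p.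
have defZ2 : <[u]> = 'Z_2(G).
  by apply/eqP; rewrite eqEcard cycle_subG Z2u oZ2 -ou /=.
have sZ2D : 'Z_2(G) \subset G^`(1) by rewrite -defZ2 cycle_subG GR.
(* As ['Z_2(G)] is cyclic, its elements killed by [p] are powers of [u ^+ p]. Hence [a ^+ p], not
   being central, also has order [p ^ 2]. *)
have Z2p1 w : w \in 'Z_2(G) -> w ^+ p = 1 -> w \in 'Z(G).
  rewrite -defZ2 => u_w wp1.
  apply: (subsetP _ w (cycle_expg_eq1 p_pr ou u_w _)).
    by rewrite cycle_subG Z2p.
  by rewrite expn1.
have Z2ap := Dp a Da.
have oap : #[a ^+ p] = (p ^ 2)%N.
  rewrite expnS expn1; apply: orderXprime => //; apply: nt_prime_order => //.
    exact/Zp/Z2p.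
  by apply: contra nZa => /eqP/Z2p1->.
have defZ2a : <[a ^+ p]> = 'Z_2(G).
  by apply/eqP; rewrite eqEcard cycle_subG Z2ap oZ2 -oap /=.
have oa : #[a] = (p ^ 3)%N.
  by rewrite expnS (orderXprime oap) // dvdn_exp.
have defD : <[a]> = G^`(1).
  apply/eqP; rewrite eqEcard cycle_subG Da.
  rewrite -(Lagrange sZ2D) -card_quotient ?(subset_trans sDG) // oZ2 -orderE oa.
  by rewrite (expnSr p 2) leq_pmul2l ?expn_gt0 ?prime_gt0.
have oGD : #|G / G^`(1)| = (p ^ 3)%N.
  have oD : #|G^`(1)| = (p ^ 3)%N by rewrite -oa orderE defD.
  rewrite card_quotient ?gFnorm // -divgS // oG oD.
  by rewrite (expnD p 3 3) mulnK ?expn_gt0 ?prime_gt0.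
have Zk : k ^+ (p ^ 2) \in 'Z(G).
  pose C := 'C_G(G^`(1)).
  have nsCG : C <| G.
    exact: char_normal (subcent_char (char_refl G) (der_char 1 G)).
  have [sCG nCG] := andP nsCG.
  have Ca g : (g \in C) = (g \in G) && ([~ g, a] == 1).
    by rewrite in_setI -defD cent_cycle (sameP cent1P commgP).
  have defC : C = 'C_G[a].
    by apply/setP=> g; rewrite Ca in_setI (sameP cent1P commgP).
  (* The conjugates of [a] lie in the coset of ['Z_2(G)] containing [a]. *)
  have oGC : #|G / C| <= p ^ 2.
    suffices: #|G : C| <= p ^ 2 by rewrite -card_quotient.
    rewrite defC index_cent1 -oZ2 -(card_lcoset _ a).
    apply/subset_leq_card/subsetP=> _ /imsetP[g Gg ->].
    by rewrite mem_lcoset conjg_mulR mulKg DG.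
  have nCkp : k ^+ p \notin C.
    have Z2v : [~ k, a] \in 'Z_2(G) by rewrite -invg_comm groupV.
    rewrite Ca groupX //= commXg_odd //; last 3 first.
    - by apply/cDZ2; [rewrite GR | rewrite DG ?GR].
    - apply/commgP; rewrite -in_set1 -[[set 1]](ucn0 G) -groupV invg_comm.
      have /ucnSP[_ ->//] : [~ [~ k, a], k] \in 'Z_1(G).
      by have /ucnSP[_ ->] := Z2v.
    - apply: Zp; rewrite -ucn1; by have /ucnSP[_ ->] := Z2v.
    by rewrite -invg_comm expgVn eq_invg1.
  have Nk := subsetP nCG k Gk.
  have defGC : <[coset C k]> = G / C.
    apply/eqP; rewrite eqEcard cycle_subG mem_quotient //= (leq_trans oGC) //.
    have pCk : p.-elt (coset C k).
      by apply: mem_p_elt (quotient_pgroup _ pG) (mem_quotient _ Gk).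
    have [n on] := p_natP pCk; rewrite -orderE on leq_exp2l //.
    rewrite ltnNge; apply: contra nCkp => le_n1.
    rewrite coset_idr ?groupX // morphX //; apply/eqP.
    by rewrite -order_dvdn on -[X in _ %| X]expn1 dvdn_exp2l.
  (* If not, [k] would have order [p ^ 3] modulo the derived subgroup, so that this quotient, and
     with it the nilpotent group [G], would be cyclic. *)
  have Dk : k ^+ (p ^ 2) \in G^`(1).
    apply: contraR nZa => nDk.
    suffices cGG : abelian G by rewrite (center_idP cGG) groupX.
    apply: cyclic_abelian; apply: cyclic_nilpotent_quo_der1_cyclic => //.
    apply/cyclicP; exists (coset G^`(1) k); apply/esym/eqP.
    have nDG := der_norm 1 G.
    rewrite eqEcard cycle_subG mem_quotient //= oGD.
    have pDk : p.-elt (coset G^`(1) k).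
      by apply: mem_p_elt (quotient_pgroup _ pG) (mem_quotient _ Gk).
    have [n on] := p_natP pDk; rewrite -orderE on leq_exp2l //.
    rewrite ltnNge; apply: contra nDk => le_n1.
    rewrite coset_idr ?groupX ?(subsetP nDG) // morphX ?(subsetP nDG) //.
    by apply/eqP; rewrite -order_dvdn on dvdn_exp2l.
  (* Every [g] is [c * k ^+ i] with [c] centralizing the derived subgroup, which contains
     [k ^+ (p ^ 2)]. *)
  apply/centerP; split=> [|g Gg]; first exact: groupX.
  have : coset C g \in <[coset C k]> by rewrite defGC mem_quotient.
  case/cycleP=> i; rewrite -morphX // => /rcoset_kercosetP.
  rewrite groupX ?(subsetP nCG) // => /(_ isT isT)/rcosetP[c Cc ->].
  apply: commuteM; last by apply/commuteX/commute_sym/commuteX.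
  by apply/commute_sym; case/setIP: Cc => _ /centP; apply.
have Z3k : k \in 'Z_3(G).
  apply/ucnSP; split=> // h Gh.
  have DkR : [~ k, h] \in G^`(1) by rewrite GR.
  rewrite -defZ2a; apply: (cycle_expg_eq1 (n := 2)) => //.
    by rewrite defD.
  (* Two [p]-th powers are taken in turn: [v] is [[~ k, h] ^+ p] up to a central factor, and [1 =
     [~ w ^+ p, h] = v ^+ p]; the next power kills the central factor, leaving [[~ k, h] ^+ (p ^ 2)
     = 1]. *)
  pose w := k ^+ p; pose v := [~ w, h].
  have Gw : w \in G by rewrite groupX.
  have Dv : v \in G^`(1) by rewrite GR.
  have [z Zz def_v] : exists2 z, z \in 'Z(G) & v = z * [~ k, h] ^+ p.
    have := commXp k h Gk Gh; move/rcoset_kercosetP.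
    rewrite !(subsetP nZG) ?groupX ?groupR // => /(_ isT isT)/rcosetP[z].
    by exists z.
  have Z2v : v \in 'Z_2(G) by rewrite def_v groupM ?Dp ?(subsetP sZZ2).
  have : [~ w ^+ p, h] = 1.
    by apply/eqP/commgP; rewrite -expgM; case/centerP: Zk => _; apply.
  rewrite commXg_odd //; last 3 first.
  - by apply: cDZ2; rewrite // DG.
  - apply/commgP; rewrite -in_set1 -[[set 1]](ucn0 G) -groupV invg_comm.
    have /ucnSP[_ ->//] : [~ v, w] \in 'Z_1(G).
    by have /ucnSP[_ ->] := Z2v.
  - apply: Zp; rewrite -ucn1; by have /ucnSP[_ ->] := Z2v.
  rewrite -/v def_v expgMn; first by rewrite Zp // mul1g -expgM.
  by case/centerP: Zz => _; apply; rewrite groupX ?(subsetP sDG).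
case/negP: ntk; apply/eqP/Zp; rewrite -ucn1.
by rewrite (subsetP (der1_comm_ucn G 1)) ?mem_commg.
Qed.

End TwoGenerator.

(** * Counting central automorphisms *)

Lemma eq_Aut_gen (gT : finGroupType) (G : {group gT}) (B : {set gT}) a b :
    <<B>> = G -> a \in Aut G -> b \in Aut G -> {in B, a =1 b} -> a = b.
Proof.
move=> defG Aa Ab eqB; apply: (eq_Aut Aa Ab).
have aM := morphicP (Aut_morphic Aa); have bM := morphicP (Aut_morphic Ab).
have gE : group_set [set x in G | a x == b x].
  apply/group_setP; split=> [|x y].
    by rewrite inE group1 -(autmE Aa) -(autmE Ab) !morph1 eqxx.
  rewrite !inE => /andP[Gx /eqP eqx] /andP[Gy /eqP eqy].
  by rewrite groupM //= aM // bM // eqx eqy.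
suffices /subsetP sGE : G \subset Group gE.
  by move=> x /sGE; rewrite inE => /andP[_ /eqP].
rewrite -{1}defG gen_subG; apply/subsetP=> x Bx; rewrite inE eqB // eqxx andbT.
by rewrite -defG mem_gen.
Qed.

Lemma card_Aut_z_leq (gT : finGroupType) (G : {group gT}) :
  #|Aut_z G| <= #|'Z(G)| ^ 'm(G).
Proof.
have [B defG <-] := grank_witness G.
(* The value [1] outside [B] gives [f a] support in [B], as [pffun_on] demands. *)
pose f (a : {perm gT}) := [ffun x => if x \in B then x^-1 * a x else 1].
rewrite -(card_pffun_on 1) -(card_in_imset (f := f)) => [|a b].
  apply/subset_leq_card/subsetP=> _ /imsetP[a /setIdP[_ /forall_inP Za] ->].
  apply/pffun_onP; split.
    by apply/subsetP=> x; rewrite !inE ffunE; case: ifP => //; rewrite eqxx.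
  move=> _ /imageP[x Bx ->]; rewrite ffunE; case: ifP => // Bx'.
  by rewrite Za // -defG mem_gen.
case/setIdP=> Aa _ /setIdP[Ab _] /ffunP eqf; apply: (eq_Aut_gen defG Aa Ab).
by move=> x Bx; have := eqf x; rewrite !ffunE Bx => /mulgI.
Qed.

Lemma Aut_z_center_Inn (gT : finGroupType) (G : {group gT}) (p : nat) :
    prime p -> odd p -> p.-group G -> #|G| = (p ^ 6)%N -> nil_class G <= 4 ->
    'm(G) = 2 -> #|'Z(G)| = p ->
  Aut_z G = 'Z(Inn G).
Proof.
move=> p_pr p_odd pG oG clG mG oZ; apply/esym/eqP.
rewrite eqEcard center_Inn_sub_Aut_z (leq_trans (card_Aut_z_leq G)) //.
rewrite mG oZ card_center_Inn.
have sZZ2 : 'Z(G) \subset 'Z_2(G) by rewrite -ucn1 ucn_subS.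
have pZ2 : p.-group 'Z_2(G) := pgroupS (ucn_sub 2 G) pG.
have [n oZ2] := p_natP (pnat_dvd (dvdn_indexg 'Z_2(G) 'Z(G)) pZ2).
rewrite oZ2 leq_exp2l ?(prime_gt1 p_pr) // leqNgt.
have := Lagrange sZZ2; rewrite oZ oZ2.
(* For index [1] the upper central series stops at ['Z(G)], which would then be all of [G]; index
   [p] contradicts [card_ucn2_neq]. *)
case: n {oZ2} => [|[|n]] // oZ2.
  have cZ2G : 'Z_2(G) = 'Z_1(G).
    by apply/esym/eqP; rewrite eqEcard ucn_subS /= ucn1 oZ -oZ2 muln1.
  have: 'Z_1(G) == G.
    have cl4 : 'Z_4(G) = G by apply/(ucn_nil_classP 4 (pgroup_nil pG)).
    have cZ3G : 'Z_3(G) = 'Z_2(G) by rewrite ucnSn cZ2G -ucnSn.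
    have cZ4G : 'Z_4(G) = 'Z_3(G) by rewrite ucnSn cZ3G -ucnSn.
    by rewrite -cZ2G -cZ3G -cZ4G cl4.
  rewrite ucn1 eqEcard center_sub /= oZ oG.
  by rewrite -[X in _ <= X]expn1 leq_exp2l ?(prime_gt1 p_pr).
by case: (card_ucn2_neq p_pr p_odd pG oG clG mG oZ); rewrite -oZ2 expn1.
Qed.

(** * Homomorphisms into the center when central automorphisms are inner *)

Section CentralInner.

Variables (gT : finGroupType) (G : {group gT}).
Hypothesis sAzI : Aut_z G \subset Inn G.

Lemma central_hom_inner (f : {morphism G >-> gT}) :
    f @* G \subset 'Z(G) -> 'Z(G) \subset 'ker f ->
  exists2 g, g \in 'Z_2(G) & {in G, forall x, f x = [~ x, g]}.
Proof.
move=> sfZ sZK; pose a x := x * f x.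
have Zf x : x \in G -> f x \in 'Z(G).
  by move=> Gx; rewrite (subsetP sfZ) ?mem_morphim.
have aM : {in G &, {morph a : x y / x * y}}.
  move=> x y Gx Gy; rewrite /a morphM // !mulgA; congr (_ * _).
  rewrite -!mulgA; congr (_ * _).
  by have /centerP[_ ->] := Zf x Gx.
pose am := Morphism aM.
have inja : 'injm am.
  apply/subsetP=> w /morphpreP[Gw /set1P /= w1]; rewrite inE.
  (* From [w * f w = 1] it follows that [w] is central, hence killed by [f], so [w = 1]. *)
  have Zw : w \in 'Z(G) by rewrite -[w](mulgK (f w)) -/(a w) w1 mul1g groupV Zf.
  by rewrite -w1 /a (mker (subsetP sZK w Zw)) mulg1.
have ima : am @* G = G.
  apply/eqP; rewrite eqEcard card_injm ?leqnn // andbT.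
  apply/subsetP=> _ /morphimP[x _ Gx ->] /=.
  by rewrite /a groupM // (subsetP (center_sub G) _ (Zf x Gx)).
have Aa : aut inja ima \in Aut_z G.
  rewrite inE Aut_aut; apply/forall_inP=> x Gx.
  by rewrite autE //= mulKg Zf.
have /morphimP[g _ Gg def_a] := subsetP sAzI _ Aa.
rewrite def_a conj_aut_Aut_z // in Aa.
exists g => // x Gx; apply: (mulgI x).
by rewrite -conjg_mulR -(conj_autE Gg Gx) -def_a autE.
Qed.

Section Matrices.

Variables (p : nat) (K E : {group gT}).
Hypotheses (nsKG : K <| G) (abG : p.-abelem (G / K)) (ntG : G / K != 1).
Hypotheses (sZK : 'Z(G) \subset K) (sEZ : E \subset 'Z(G)).
Hypotheses (abE : p.-abelem E) (ntE : E :!=: 1).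

Let rowG x := abelem_rV abG ntG (coset K x).

Lemma mx_hom_inner (A : 'M_('dim (G / K), 'dim E)) :
  exists2 g, g \in 'Z_2(G)
    & {in G, forall x, [~ x, g] = rVabelem abE ntE (rowG x *m A)%R}.
Proof.
have nKG := normal_norm nsKG.
pose f x := rVabelem abE ntE (rowG x *m A)%R.
have fM : {in G &, {morph f : x y / x * y}}.
  move=> x y Gx Gy; rewrite /f /rowG morphM ?(subsetP nKG) //=.
  by rewrite abelem_rV_M ?mem_quotient // mulmxDl rVabelemD.
have [||g Zg fE] := @central_hom_inner (Morphism fM).
- apply/subsetP=> _ /morphimP[x _ Gx ->] /=.
  by rewrite (subsetP sEZ) ?mem_rVabelem.
- apply/subsetP=> z Zz; have Gz := subsetP (center_sub G) z Zz.
  apply/kerP=> //=; rewrite /f /rowG coset_id ?(subsetP sZK) //.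
  by rewrite abelem_rV_1 mul0mx rVabelem0.
by exists g => // x Gx; rewrite -fE.
Qed.

Lemma rowG_surj u : exists2 x, x \in G & rowG x = u.
Proof.
have /morphimP[x _ Gx def_u] := mem_rVabelem abG ntG u.
by exists x => //; rewrite /rowG -[coset K x]def_u rVabelemK.
Qed.

Lemma cent_ucn2_sub : 'C_G('Z_2(G)) \subset K.
Proof.
apply/subsetP=> x /setIP[Gx /centP cx]; apply: contraR ntE => nKx.
have Nx := subsetP (normal_norm nsKG) x Gx.
have : rowG x != 0%R.
  apply: contra nKx => /eqP rx0; rewrite coset_idr //.
  rewrite -[coset K x](abelem_rV_K abG ntG) ?mem_quotient //.
  by rewrite -/(rowG x) rx0 rVabelem0.
case/rV0Pn=> i rxi.
(* This matrix reads off the nonzero [i]-th coordinate of [rowG x], whereas [x] commutes with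
   [g]. *)
have [g Z2g /(_ x Gx)] := mx_hom_inner (delta_mx i ord0).
have /eqP-> : [~ x, g] == 1 by apply/commgP/cx.
rewrite -(rVabelem0 abE ntE) => /rVabelem_inj/rowP/(_ ord0).
rewrite !mxE (bigD1 i) //= big1 => [|j ne_ji]; last first.
  by rewrite !mxE (negPf ne_ji) mulr0.
by rewrite !mxE !eqxx mulr1 addr0 => /eqP; rewrite eq_sym (negPf rxi).
Qed.

Lemma card_mx_hom_inner :
  p ^ (logn p #|G / K| * logn p #|E|) <= #|'Z_2(G) : 'Z(G)|.
Proof.
pose P A g := [forall x in G, [~ x, g] == rVabelem abE ntE (rowG x *m A)%R].
(* The default [1] never occurs, by [mx_hom_inner]. The coset determines [A] because a central
   factor of [g] does not change [[~ x, g]]. *)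
pose h A := 'Z(G) :* odflt 1 [pick g in 'Z_2(G) | P A g].
have p_pr : prime p by have [] := pgroup_pdiv (abelem_pgroup abE) ntE.
have hP A : exists g, [/\ g \in 'Z_2(G), P A g & h A = 'Z(G) :* g].
  rewrite /h; case: pickP => [g /andP[] | /= noP]; first by exists g.
  have [g Z2g fE] := mx_hom_inner A; case/idP: (noP g).
  by rewrite Z2g; apply/forall_inP=> x Gx; rewrite fE.
have injh : injective h.
  move=> A B; have [g [Z2g /forall_inP gA ->]] := hP A.
  have [k [Z2k /forall_inP kB ->]] := hP B => eq_gk.
  have eqAB (u : 'rV_('dim (G / K))) : (u *m A = u *m B)%R.
    have [x Gx <-] := rowG_surj u; apply: (@rVabelem_inj p _ E abE ntE).
    rewrite -(eqP (gA x Gx)) -(eqP (kB x Gx)).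
    have /rcosetP[z Zz ->] : g \in 'Z(G) :* k by rewrite -eq_gk rcoset_refl.
    rewrite commgMJ.
    have /commgP/eqP-> : commute x z.
      by apply/commute_sym; case/centerP: Zz => _; apply.
    by rewrite conj1g mulg1.
  by apply/row_matrixP=> i; rewrite !rowE.
have sh : h @: setT \subset rcosets 'Z(G) 'Z_2(G).
  apply/subsetP=> _ /imsetP[A _ ->]; have [g [Z2g _ ->]] := hP A.
  by apply/rcosetsP; exists g.
apply: leq_trans (subset_leq_card sh).
rewrite card_imset // cardsT card_mx card_Fp //.
by rewrite (dim_abelemE abG ntG) (dim_abelemE abE ntE).
Qed.

End Matrices.

End CentralInner.

(** An element of maximal order generates a direct factor; send it to [z] and kill a complement. *)
Lemma abelian_hom_cycle (aT rT : finGroupType) (A : {group aT}) a (z : rT) :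
    abelian A -> a \in A -> #[a] = exponent A -> #[z] %| #[a] ->
  exists2 f : {morphism A >-> rT}, f @* A \subset <[z]> & f a = z.
Proof.
move=> cAA Aa oa dvz.
have /splitsP[L /complP[tiaL defA]] := abelian_splits Aa oa cAA.
have sLA : L \subset A by rewrite -defA mulG_subr.
have dpA : <[a]> \x L = A.
  rewrite dprodE // (subset_trans sLA) // (subset_trans cAA) // centS //.
  by rewrite cycle_subG.
have cfL : trivm L @* L \subset 'C(eltm dvz @* <[a]>).
  by rewrite morphim_trivm sub1G.
exists (dprodm_morphism dpA cfL) => /=.
  by rewrite im_dprodm morphim_trivm mulg1 im_eltm.
by rewrite dprodmEl ?cycle_id //= eltm_id.
Qed.

Lemma cyclic_pgroup_leq1 (gT : finGroupType) (H : {group gT}) (p n : nat) :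
  prime p -> #|H| = (p ^ n)%N -> n <= 1 -> cyclic H.
Proof.
move=> p_pr oH; case: n oH => [|[|n]] // oH _; last first.
  by apply: prime_cyclic; rewrite oH expn1.
by rewrite (card1_trivg oH) cyclic1.
Qed.

(** * Central automorphisms all inner: rank two and a center of order p *)

Section InnerCentral.

Variables (gT : finGroupType) (G : {group gT}) (p : nat).
Hypotheses (p_pr : prime p) (pG : p.-group G) (oG : #|G| = (p ^ 6)%N).
Hypotheses (clG : 2 < nil_class G) (sAzI : Aut_z G \subset Inn G).

Let sZG := center_sub G.
Let sZ2G := ucn_sub 2 G.
Let nZG : G \subset 'N('Z(G)) := gFnorm _ G.
Let nZ2G := ucn_norm 2 G.
Let sZZ2 : 'Z(G) \subset 'Z_2(G). Proof. by rewrite -ucn1 ucn_subS. Qed.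
Let pZ : p.-group 'Z(G) := pgroupS sZG pG.

(** [G / K] is the largest elementary abelian quotient of [G] in which the center dies. *)
Let K := ('Z(G) <*> 'Phi(G))%G.
Let nsKG : K <| G.
Proof. by rewrite normalY ?Phi_normal ?center_normal. Qed.
Let sZK : 'Z(G) \subset K := joing_subl _ _.
Let sPhiK : 'Phi(G) \subset K := joing_subr _ _.

Let abG : p.-abelem (G / K).
Proof.
have [_ nKG] := andP nsKG.
by rewrite -(trivg_Phi (quotient_pgroup _ pG)) -(quotient_Phi pG) // quotientS1.
Qed.

Let nabG : ~~ abelian (G / 'Z(G)).
Proof.
apply: contraL clG => cGZ; rewrite -leqNgt.
apply/(ucn_nil_classP 2 (pgroup_nil pG))/eqP; rewrite eqEsubset sZ2G.
have sDZ := der1_min nZG cGZ.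
apply/subsetP=> x Gx; apply/ucnSP; split=> // y Gy.
by rewrite ucn1 (subsetP sDZ) ?mem_commg.
Qed.

(** This is [G / 'Z(G)] modulo its own center, and [G / 'Z(G)] is not abelian. *)
Let ncG : ~~ cyclic (G / 'Z_2(G)).
Proof.
apply: contra nabG => cycG; apply: cyclic_center_factor_abelian.
rewrite -ucn1 -ucn_central.
have isoG2 := third_isog (ucn_subS 1 G) (ucn_normal 1 G) (ucn_normal 2 G).
by rewrite (isog_cyclic isoG2).
Qed.

(** If [x] generated [G] modulo [K], then ['Z(G)] and [x] would generate [G], up to non-generators,
    and [G] would be abelian. *)
Let ncGK : ~~ cyclic (G / K).
Proof.
apply: contra nabG => /cyclicP[xb def_xb].
have /morphimP[x Nx Gx def_x] : xb \in G / K by rewrite def_xb cycle_id.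
have [sKG nKG] := andP nsKG.
suffices defG : 'Z(G) <*> <[x]> = G.
  have: abelian ('Z(G) <*> <[x]>).
    rewrite abelianY center_abelian cycle_abelian cycle_subG /=.
    by apply/centP=> z /centerP[_ cz]; apply/commute_sym/cz.
  by rewrite defG => /quotient_abelian.
have: 'Phi(G) <*> ('Z(G) <*> <[x]>) = G; last first.
  by move/Phi_nongen; rewrite genGid.
apply/eqP; rewrite eqEsubset !join_subG Phi_sub sZG cycle_subG Gx /=.
rewrite joingA [_ <*> 'Z(G)]joingC -(quotientSGK nKG) ?joing_subl //.
by rewrite quotientYidl ?cycle_subG // quotient_cycle // -def_x -def_xb.
Qed.

Let E := 'Ohm_1('Z(G))%G.
Let abE : p.-abelem E. Proof. by rewrite Ohm1_abelem ?center_abelian. Qed.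
Let ntE : E :!=: 1.
Proof.
rewrite Ohm1_eq1; apply: contra nabG => /eqP/(trivg_center_pgroup pG) G1.
by rewrite quotient_abelian // G1 abelian1.
Qed.
Let sEZ : E \subset 'Z(G) := Ohm_sub 1 _.

Let ntG : G / K != 1.
Proof. by apply: contra ncGK => /eqP->; apply: cyclic1. Qed.

Let cZ2K : 'C_G('Z_2(G)) \subset K.
Proof. exact: (cent_ucn2_sub sAzI nsKG abG ntG sZK sEZ abE ntE). Qed.

Let abGZ2 : #|'Z_2(G)| = (p ^ 4)%N -> p.-abelem (G / 'Z_2(G)).
Proof.
move=> oZ2; apply: noncyclic_p2_abelem => //.
rewrite card_quotient // -divgS // oG oZ2 (expnD p 2 4).
by rewrite mulnK ?expn_gt0 ?prime_gt0.
Qed.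

Let sPhiZ2 : #|'Z_2(G)| = (p ^ 4)%N -> 'Phi(G) \subset 'Z_2(G).
Proof. by move=> oZ2; apply: Phi_min pG nZ2G (abGZ2 oZ2). Qed.

(** The Frattini subgroup centralizes ['Z_2(G)], so [K] is central of index [p] in it. Then
    ['Z_2(G)] is abelian, and [cZ2K] forces it into the smaller group [K]. *)
Let index_center_Phi_neq_p3 :
  #|'Z(G)| = p -> #|'Z_2(G)| = (p ^ 4)%N -> #|G / K| <> (p ^ 3)%N.
Proof.
move=> oZ oZ2 oGK.
have Zp z : z \in 'Z(G) -> z ^+ p = 1.
  by move=> Zz; apply/eqP; rewrite -order_dvdn -oZ order_dvdG.
have sKZ2 : K \subset 'Z_2(G) by rewrite join_subG sZZ2 sPhiZ2.
have cZ2Phi : 'Phi(G) \subset 'C('Z_2(G)).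
  rewrite (Phi_joing pG) join_subG; apply/andP; split.
    by apply/commG1P/trivgP; rewrite -(ucn0 G) der1_comm_ucn.
  rewrite (MhoE 1 pG) gen_subG; apply/subsetP=> _ /imsetP[x Gx ->].
  apply/centP=> u Z2u; apply/commute_sym/commgP; rewrite expn1.
  have Zux : [~ u, x] \in 'Z(G) by rewrite -ucn1; case/ucnSP: Z2u => _ ->.
  rewrite commgX ?Zp //; apply/commute_sym.
  by case/centerP: Zux => _; apply.
have sKC : K \subset 'Z('Z_2(G)).
  rewrite subsetI sKZ2 join_subG cZ2Phi andbT.
  by rewrite (subset_trans (subsetIr G _)) // centS.
have oK : #|K| = (p ^ 3)%N.
  have := Lagrange (normal_sub nsKG).
  rewrite -card_quotient ?normal_norm // oGK oG (expnD p 3 3) => /eqP.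
  by rewrite eqn_pmul2r ?expn_gt0 ?prime_gt0 // => /eqP.
have cZ2 : abelian 'Z_2(G).
  apply: cyclic_factor_abelian sKC _; apply: prime_cyclic.
  rewrite card_quotient ?(subset_trans sZ2G) ?normal_norm // -divgS // oZ2 oK.
  by rewrite (expnD p 1 3) mulnK ?expn_gt0 ?prime_gt0 // expn1.
have: 'Z_2(G) \subset K by rewrite (subset_trans _ cZ2K) // subsetI sZ2G.
move/subset_leq_card; rewrite oZ2 oK.
by rewrite leq_exp2l ?(prime_gt1 p_pr).
Qed.

(** A homomorphism onto the cyclic center yields [[~ x, g] = z] with [z] of order [p ^ 2], while [g]
    turns out to have centralizer [K], which contains [x ^+ p]; so [z ^+ p = 1]. *)
Let index_center_Phi_neq_p2 :
    #|'Z(G)| = (p ^ 2)%N -> cyclic 'Z(G) -> #|'Z_2(G)| = (p ^ 4)%N ->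
  #|G / K| <> (p ^ 2)%N.
Proof.
move=> oZ /cyclicP[z defZ] oZ2 oGK.
have oz : #[z] = (p ^ 2)%N by rewrite orderE -defZ.
have sKZ2 : K \subset 'Z_2(G) by rewrite join_subG sZZ2 sPhiZ2.
have oK : #|K| = (p ^ 4)%N.
  have := Lagrange (normal_sub nsKG).
  rewrite -card_quotient ?normal_norm // oGK oG (expnD p 4 2) => /eqP.
  by rewrite eqn_pmul2r ?expn_gt0 ?prime_gt0 // => /eqP.
have [cG2 G2p] := abelemP p_pr (abGZ2 oZ2).
have sDZ2 : G^`(1) \subset 'Z_2(G) := der1_min nZ2G cG2.
have Z2X x : x \in G -> x ^+ p \in 'Z_2(G).
  move=> Gx; have Nx := subsetP nZ2G x Gx.
  by rewrite coset_idr ?groupX // morphX // G2p // mem_quotient.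
have oD : #|G^`(1) / 'Z(G)| %| p.
  have mGZ : 'm(G / 'Z(G)) <= 2.
    rewrite -(leq_exp2l _ _ (prime_gt1 p_pr)).
    rewrite -(card_Frattini_quotient (quotient_pgroup _ pG)).
    rewrite -(quotient_Phi pG) //.
    rewrite -(quotientYidl (subset_trans (Phi_sub G) nZG)).
    have sGZK : G :&: 'Z(G) \subset K := subset_trans (subsetIr _ _) sZK.
    rewrite (index_quotient_eq sGZK (normal_sub nsKG) nZG) -oGK.
    by rewrite card_quotient ?normal_norm.
  have sDZ : (G / 'Z(G))^`(1) \subset 'Z(G / 'Z(G)).
    have := ucn_central 1 G; rewrite ucn1 => <-.
    by rewrite -quotient_der // quotientS.
  have [_ [_ [/morphimP[x Nx Gx ->] /morphimP[y Ny Gy ->]]]] :=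
    der1_grank2 mGZ sDZ.
  rewrite quotient_der // => ->; rewrite -orderE order_dvdn -commXg; last first.
    have /centerP[_ cxy] : [~ coset 'Z(G) x, coset 'Z(G) y] \in 'Z(G / 'Z(G)).
      by rewrite (subsetP sDZ) ?mem_commg ?mem_quotient.
    by apply/commute_sym/cxy/mem_quotient.
  rewrite -morphX // -morphR ?groupX //= coset_id // -ucn1.
  by have /ucnSP[_ ->] := Z2X x Gx.
pose D := ('Z(G) <*> G^`(1))%G.
have nsDG : D <| G by rewrite normalY ?center_normal ?der_normal.
have [sDG nDG] := andP nsDG.
have cGD : abelian (G / D) by rewrite sub_der1_abelian // joing_subr.
have pGD : p.-group (G / D) := quotient_pgroup _ pG.
have [a GDa oa] := exponent_witness (abelian_nil cGD).
(* If [G / D] had exponent at most [p], then [K] would lie in [D], and [K / 'Z(G)], of order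
   [p ^ 2], would have order at most [p] by [oD]. *)
have dvza : #[z] %| #[a].
  have [n on] := p_natP (mem_p_elt pGD GDa).
  rewrite oz on dvdn_exp2l // ltnNge; apply/negP=> n_le1.
  have abGD : p.-abelem (G / D).
    rewrite abelemE // cGD oa on -[X in _ %| X]expn1 dvdn_exp2l //.
  have sKD : K \subset D by rewrite join_subG joing_subl (Phi_min pG).
  have : #|K / 'Z(G)| <= p.
    apply: leq_trans (dvdn_leq (prime_gt0 p_pr) oD).
    rewrite subset_leq_card // (subset_trans (quotientS _ sKD)) //.
    by rewrite quotientYidl // (subset_trans (der_sub 1 G)).
  rewrite card_quotient ?(subset_trans (normal_sub nsKG)) // -divgS // oK oZ.
  rewrite (expnD p 2 2) mulnK ?expn_gt0 ?prime_gt0 // -[X in _ <= X]expn1.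
  by rewrite leq_exp2l ?(prime_gt1 p_pr).
have [f sfz fa] := abelian_hom_cycle cGD GDa (esym oa) dvza.
have fM : {in G &, {morph (fun x => f (coset D x)) : x y / x * y}}.
  move=> x y Gx Gy; rewrite morphM ?(subsetP nDG) //=.
  by rewrite morphM ?mem_quotient.
have [||g Z2g fE] := central_hom_inner sAzI (f := Morphism fM).
- rewrite defZ; apply/subsetP=> _ /morphimP[x _ Gx ->] /=.
  by rewrite (subsetP sfz) // mem_morphim ?mem_quotient.
- apply/subsetP=> u Zu; apply/kerP=> /=; first exact: subsetP sZG u Zu.
  by rewrite coset_id ?morph1 // (subsetP (joing_subl _ _)).
have /morphimP[x Nx Gx def_a] := GDa.
have xg : [~ x, g] = z by rewrite -fE //= -[coset D x]def_a fa.
have Gg := subsetP sZ2G g Z2g.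
have Zxg y n : y \in G ->
    [~ y, g ^+ n] = [~ y, g] ^+ n /\ [~ y ^+ n, g] = [~ y, g] ^+ n.
  move=> Gy; have /centerP[_ cyg] : [~ y, g] \in 'Z(G).
    by rewrite -ucn1 -groupV invg_comm; have /ucnSP[_ ->] := Z2g.
  by split; [rewrite commgX | rewrite commXg] => //; apply/commute_sym/cyg.
have zp : z ^+ p != 1.
  by rewrite -order_dvdn oz -[X in _ %| X]expn1 dvdn_Pexp2l ?(prime_gt1 p_pr).
(* As [[~ x, g ^+ p] = z ^+ p] is not trivial, [g] has order at least [p ^ 2] modulo ['Z(G)]. *)
have defZ2 : 'Z_2(G) = 'Z(G) <*> <[g]>.
  apply/eqP; rewrite eqEsubset join_subG sZZ2 cycle_subG Z2g andbT.
  have Ng := subsetP nZG g Gg.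
  rewrite -(quotientSGK _ (joing_subl _ _)) ?(subset_trans sZ2G) //.
  rewrite quotientYidl ?cycle_subG // quotient_cycle //.
  have sgZ2 : <[coset 'Z(G) g]> \subset 'Z_2(G) / 'Z(G).
    by rewrite cycle_subG mem_quotient.
  have pg : p.-elt (coset 'Z(G) g).
    by apply: mem_p_elt (quotient_pgroup _ pG) (mem_quotient _ Gg).
  have [n on] := p_natP pg.
  rewrite -(geq_leqif (subset_leqif_card sgZ2)).
  rewrite card_quotient ?(subset_trans sZ2G) // -divgS //.
  rewrite oZ2 oZ (expnD p 2 2) mulnK ?expn_gt0 ?prime_gt0 // -orderE on andbT.
  rewrite leq_exp2l ?(prime_gt1 p_pr) // ltnNge; apply: contra zp => n_le1.
  rewrite -xg -(Zxg x p Gx).1; apply/commgP.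
  have Zgp : g ^+ p \in 'Z(G).
    rewrite coset_idr ?groupX // morphX //; apply/eqP.
    by rewrite -order_dvdn on -[X in _ %| X]expn1 dvdn_exp2l.
  by apply/commute_sym; case/centerP: Zgp => _; apply.
(* The centralizer of [g] is that of ['Z_2(G)], hence inside [K]; its index is at most
   [#|'Z(G)| = p ^ 2]. *)
have defK : 'C_G[g] = K.
  apply/eqP; rewrite eqEcard (subset_trans _ cZ2K) /=; last first.
    rewrite subsetI subsetIl defZ2 centY subsetI cent_cycle subsetIr andbT.
    by rewrite (subset_trans (subsetIl _ _)) // centsC subsetIr.
  have iC : #|G : 'C_G[g]| <= p ^ 2.
    rewrite index_cent1 -oZ -(card_lcoset _ g).
    apply/subset_leq_card/subsetP=> _ /imsetP[y Gy ->].
    rewrite mem_lcoset conjg_mulR mulKg -ucn1.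
    by have /ucnSP[_ ->] := Z2g.
  rewrite oK -(leq_pmul2r (m := p ^ 2)) ?expn_gt0 ?prime_gt0 // -expnD -oG.
  by rewrite -(Lagrange (subsetIl G 'C[g])) leq_mul2l iC orbT.
have Cxp : x ^+ p \in 'C_G[g].
  have NKx := subsetP (normal_norm nsKG) x Gx.
  have [_ GKp] := abelemP p_pr abG.
  by rewrite defK coset_idr ?groupX // morphX // GKp // mem_quotient.
case/negP: zp; rewrite -xg -(Zxg x p Gx).2; apply/commgP.
by apply/commute_sym; case/subcent1P: Cxp.
Qed.

Lemma inner_central_cond : 'm(G) = 2 /\ #|'Z(G)| = p.
Proof.
have [n1 oZ] := p_natP pZ.
have [n2 oZ2] := p_natP (pgroupS sZ2G pG).
have [r or] := p_natP (quotient_pgroup K pG : p.-nat _).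
have [s os] := p_natP (abelem_pgroup abE).
have p_gt1 := prime_gt1 p_pr.
have n2_le4 : n2 <= 4.
  have [m om] := p_natP (quotient_pgroup 'Z_2(G) pG : p.-nat _).
  have m_gt1 : 1 < m.
    by rewrite ltnNge; apply: contra ncG; apply: cyclic_pgroup_leq1 om.
  have := Lagrange sZ2G; rewrite -card_quotient // om oZ2 oG -expnD => /eqP.
  rewrite eqn_exp2l // => /eqP def6.
  by rewrite -(leq_add2r 2) -[(4 + 2)%N]def6 leq_add2l.
have r_gt1 : 1 < r.
  by rewrite ltnNge; apply: contra ncGK; apply: cyclic_pgroup_leq1 or.
have s_gt0 : 0 < s.
  rewrite lt0n; apply: contra ntE => /eqP s0.
  by apply/eqP/card1_trivg; rewrite os s0.
have s_le : s <= n1.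
  by rewrite -(leq_exp2l _ _ p_gt1) -oZ -os subset_leq_card.
have rs_le : r * s + n1 <= n2.
  have := card_mx_hom_inner sAzI nsKG abG ntG sZK sEZ abE ntE.
  rewrite or os !pfactorK // -(leq_pmul2l (cardG_gt0 'Z(G))) Lagrange //.
  by rewrite oZ oZ2 -expnD leq_exp2l // addnC.
have rs_le4 : r * s + n1 <= 4 := leq_trans rs_le n2_le4.
have r_le : r <= r * s by rewrite leq_pmulr.
have s_le_rs : 2 * s <= r * s by rewrite leq_mul2r r_gt1 orbT.
have n1_le2 : n1 <= 2.
  by rewrite -(leq_add2l 2) (leq_trans _ rs_le4) // leq_add2r (leq_trans r_gt1).
have n1_gt0 : 0 < n1 := leq_trans s_gt0 s_le.
(* The bound [r * s + n1 <= n2 <= 4] with [r >= 2] and [s >= 1] leaves [n1 = 1] with [r] equal to 2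
   or 3, or [n1 = r = 2] with [s = 1]. *)
have [n1_1 | n1_2] : n1 = 1%N \/ n1 = 2.
- by case: (n1) n1_le2 n1_gt0 => [|[|[|]]] // _ _; [left | right].
- have Z1 : #|'Z(G)| = p by rewrite oZ n1_1 expn1.
  (* A center of prime order lies in the derived subgroup, since they meet nontrivially; thus [K] is
     ['Phi(G)] and [r] is the rank. *)
  split=> //; have sZPhi : 'Z(G) \subset 'Phi(G).
    apply: (subset_trans (B := G^`(1))); last first.
      by rewrite (Phi_joing pG) joing_subl.
    apply: prime_meetG; first by rewrite Z1.
    rewrite setIC meet_center_nil ?(pgroup_nil pG) ?der_normal //.
    by apply: contra nabG => /eqP/derG1P/quotient_abelian.
  have defK : K :=: 'Phi(G) by apply/joing_idPr.
  have : (p ^ r = p ^ 'm(G))%N.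
    rewrite -or -(card_Frattini_quotient pG) -defK.
    by rewrite card_quotient ?normal_norm.
  move/eqP; rewrite eqn_exp2l // => /eqP <-; apply/eqP.
  rewrite eqn_leq r_gt1 andbT leqNgt; apply/negP=> r_gt2.
  have rs3 : 3 <= r * s := leq_trans r_gt2 r_le.
  have r3 : r = 3.
    apply/eqP; rewrite eqn_leq r_gt2 andbT (leq_trans r_le) //.
    by rewrite -(leq_add2r 1) -{1}n1_1.
  have n2_4 : n2 = 4.
    apply/eqP; rewrite eqn_leq n2_le4 (leq_trans _ rs_le) //.
    by rewrite n1_1 -[4]/(3 + 1)%N leq_add2r.
  by apply: index_center_Phi_neq_p3 => //; [rewrite oZ2 n2_4 | rewrite or r3].
have rs2 : r * s <= 2 by rewrite -(leq_add2r 2) -{1}n1_2.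
have r2 : r = 2 by apply/eqP; rewrite eqn_leq r_gt1 (leq_trans r_le).
have s1 : s = 1%N.
  by apply/eqP; rewrite eqn_leq s_gt0 andbT -(leq_pmul2l (m := 2)) // -{1}r2.
have n2_4 : n2 = 4.
  apply/eqP; rewrite eqn_leq n2_le4 (leq_trans _ rs_le) //.
  by rewrite n1_2 r2 s1.
case: index_center_Phi_neq_p2; rewrite ?oZ ?n1_2 ?oZ2 ?n2_4 ?or ?r2 //.
(* The center is cyclic because [s = 1] is its rank. *)
rewrite abelian_rank1_cyclic ?center_abelian // -rank_Ohm1.
by rewrite (rank_abelem abE) os pfactorK // s1.
Qed.

End InnerCentral.

Theorem theorem3p3 (gT : finGroupType) (G : {group gT}) (p : nat)
    (p_pr : prime p) (p_odd : odd p) (pG : p.-group G)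
    (oG : #|G| = (p ^ 6)%N) (clG : nil_class G = 3 \/ nil_class G = 4) :
  Aut_z G = 'Z(Inn G) <-> 'm(G) = 2 /\ #|'Z(G)| = p.
Proof.
split=> [AzI | [mG oZ]].
  apply: (inner_central_cond p_pr pG oG); last by rewrite AzI center_sub.
  by case: clG => ->.
by apply: (Aut_z_center_Inn p_pr p_odd pG oG) => //; case: clG => ->.
Qed.
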